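(* Let $\Sigma$, $\rho$, $E(x,y)$, $\mathbb Q$, $\mathbb{IQ}$ and $\mathcal I$ be as in the context. Then: (i) for each $J\in\mathbb{IQ}$ and each $f\in\Sigma$, the set $C(J)=\{x\in J\mid\nabla x=x=\Delta x\}$ is closed under $f^J$; (ii) the assignment $\mathcal C\colon\mathbb{IQ}\to\mathbb Q$ sending $J$ to the $\Sigma$-algebra $\mathcal C(J)$ with universe $C(J)$ and operations $f^J$ restricted to $C(J)$, and sending a homomorphism $g\colon J\to K$ to its restriction to $C(J)$, is a well-defined faithful functor (in particular $\mathcal C(J)\in\mathbb Q$); (iii) for each $A\in\mathbb Q$ the map $\iota_A\colon A\to\mathcal C(\mathcal I(A))$, $\iota_A(a)=[a,a]$, is an isomorphism, and $A\mapsto\iota_A$ is a natural isomorphism from the identity functor of $\mathbb Q$ to $\mathcal C\circ\mathcal I$; (iv) for each $J\in\mathbb{IQ}$ the map $\gamma_J\colon J\to\mathcal I(\mathcal C(J))$, $\gamma_J(a)=[\Delta a,\nabla a]$, is a one-to-one homomorphism, and $J\mapsto\gamma_J$ is a natural transformation from the identity functor of $\mathbb{IQ}$ to $\mathcal I\circ\mathcal C$.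
   Context: $\Sigma$ is a set of constant and function symbols containing constants $0,1$. A polarity $\rho$ assigns to each $n$-ary function symbol $f\in\Sigma$ a tuple $\rho(f)\in\{+,-\}^n$. A $\rho$-poalgebra is a pair $(A,\leq)$ with $A$ a $\Sigma$-algebra and $\leq$ a partial order on $A$ such that each $f^A$ is monotone in its $k$-th argument if $\rho(f)_k=+$ and antitone if $\rho(f)_k=-$; it is bounded if $0^A\leq a\leq 1^A$ for all $a$. For a bounded $\rho$-poalgebra $A$, $\mathcal I(A)$ is the $(\Sigma\cup\{\Delta,\nabla,\iota\})$-algebra on $I(A)=\{[a,b]\mid a\leq b\}$ with $f^{\mathcal I(A)}([a_1,b_1],\dots,[a_n,b_n])=[f^A(c_1,\dots,c_n),f^A(d_1,\dots,d_n)]$, where $c_k=a_k,d_k=b_k$ if $\rho(f)_k=+$ and $c_k=b_k,d_k=a_k$ if $\rho(f)_k=-$, $\Delta[a,b]=[a,a]$, $\nabla[a,b]=[b,b]$, $\iota=[0^A,1^A]$. A set $E(x,y)$ of $\Sigma$-equations determines the order of $A$ if $a\leq b$ iff $t^A(a,b)=s^A(a,b)$ for all $t=s$ in $E(x,y)$. Standing assumptions: $\mathbb Q$ is a $\Sigma$-quasivariety of bounded $\rho$-poalgebras whose order is determined by a fixed set $E(x,y)$ of $\Sigma$-equations; $\mathbb{IQ}$ is the quasivariety generated by $\{\mathcal I(A)\mid A\in\mathbb Q\}$; both are categories with homomorphisms. $\mathcal I\colon\mathbb Q\to\mathbb{IQ}$ is the functor $A\mapsto\mathcal I(A)$, $h\mapsto\mathcal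 I(h)$ with $\mathcal I(h)([a,b])=[h(a),h(b)]$. *)

(* Defs.v *)
From mathcomp Require Import all_boot.
From mathcomp Require Import boolp.

Set Implicit Arguments.
Unset Strict Implicit.
Unset Printing Implicit Defensive.

Record signature := Signature {
  csym : Type;
  fsym : Type;
  ar : fsym -> nat }.

Record algebra (S : signature) := Algebra {
  carrier :> Type;
  cst : csym S -> carrier;
  op : forall f : fsym S, ('I_(ar f) -> carrier) -> carrier }.

Arguments cst {S} A c : rename.
Arguments op {S} A f a : rename.

Record is_hom (S : signature) (A B : algebra S) (h : A -> B) : Prop := IsHom {
  hom_cst : forall c, h (cst A c) = cst B c;
  hom_op : forall f (a : 'I_(ar f) -> A),
    h (op A f a) = op B f (fun k => h (a k)) }.

Record hom (S : signature) (A B : algebra S) := Hom {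
  hfun :> A -> B;
  homP : is_hom hfun }.

Inductive term (S : signature) (V : Type) : Type :=
  | Var of V
  | Cst of csym S
  | App (f : fsym S) of ('I_(ar f) -> term S V).

Fixpoint eval (S : signature) (V : Type) (A : algebra S) (v : V -> A)
    (t : term S V) : A :=
  match t with
  | Var x => v x
  | Cst c => cst A c
  | App f ts => op A f (fun k => eval v (ts k))
  end.

Definition equation (S : signature) (V : Type) : Type :=
  (term S V * term S V)%type.

Definition holds (S : signature) (V : Type) (A : algebra S) (v : V -> A)
    (e : equation S V) : Prop :=
  eval v e.1 = eval v e.2.

Record quasiequation (S : signature) := Quasiequation {
  npremises : nat;
  premise : 'I_npremises -> equation S nat;
  conclusion : equation S nat }.

Definition satisfies (S : signature) (A : algebra S) (q : quasiequation S) :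
    Prop :=
  forall v : nat -> A,
    (forall i, holds v (premise (q := q) i)) -> holds v (conclusion q).

Definition quasivariety (S : signature) (K : algebra S -> Prop) : Prop :=
  exists T : quasiequation S -> Prop,
    forall A, K A <-> (forall q, T q -> satisfies A q).

Definition generated_quasivariety (S : signature) (K : algebra S -> Prop)
    (A : algebra S) : Prop :=
  forall V : algebra S -> Prop,
    quasivariety V -> (forall B, K B -> V B) -> V A.

Record obj (S : signature) (K : algebra S -> Prop) := Obj {
  oalg :> algebra S;
  objP : K oalg }.

Lemma is_hom_id (S : signature) (A : algebra S) : @is_hom S A A (fun x => x).
Proof. by []. Qed.

Lemma is_hom_comp (S : signature) (A B C : algebra S) (g : hom B C)
  (h : hom A B) : is_hom (fun x => g (h x)).
Proof.
split=> [c|f a]; first by rewrite (hom_cst (homP h)) (hom_cst (homP g)).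
by rewrite (hom_op (homP h)) (hom_op (homP g)).
Qed.

Definition hid (S : signature) (A : algebra S) : hom A A := Hom (is_hom_id A).

Definition hcomp (S : signature) (A B C : algebra S) (g : hom B C)
  (h : hom A B) : hom A C := Hom (is_hom_comp g h).

Lemma homE (S : signature) (A B : algebra S) (g h : hom A B) :
  (forall x, g x = h x) -> g = h.
Proof.
case: g h => [g gP] [h hP] /= gh.
have {}gh : g = h by apply: funext.
by subst h; congr Hom; apply: Prop_irrelevance.
Qed.

Definition isomorphism (S : signature) (A B : algebra S) (h : hom A B) : Prop :=
  exists k : hom B A, hcomp k h = hid A /\ hcomp h k = hid B.

Record functor_data (S T : signature)
    (K : algebra S -> Prop) (L : algebra T -> Prop) := FunctorData {
  fobj :> obj K -> obj L;
  fmap : forall A B : obj K, hom A B -> hom (fobj A) (fobj B) }.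

Record is_functor (S T : signature)
    (K : algebra S -> Prop) (L : algebra T -> Prop)
    (F : functor_data K L) : Prop := IsFunctor {
  fmap_id : forall A : obj K, fmap F (hid A) = hid (F A);
  fmap_comp : forall (A B C : obj K) (g : hom B C) (h : hom A B),
    fmap F (hcomp g h) = hcomp (fmap F g) (fmap F h) }.

Definition faithful (S T : signature)
    (K : algebra S -> Prop) (L : algebra T -> Prop)
    (F : functor_data K L) : Prop :=
  forall (A B : obj K) (g h : hom A B), fmap F g = fmap F h -> g = h.

Definition id_functor (S : signature) (K : algebra S -> Prop) :
    functor_data K K :=
  @FunctorData S S K K (fun A => A) (fun A B h => h).

Definition comp_functor (S T U : signature) (K : algebra S -> Prop)
    (L : algebra T -> Prop) (M : algebra U -> Prop)
    (G : functor_data L M) (F : functor_data K L) : functor_data K M :=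
  @FunctorData S U K M (fun A => G (F A)) (fun A B h => fmap G (fmap F h)).

Definition natural (S T : signature)
    (K : algebra S -> Prop) (L : algebra T -> Prop)
    (F G : functor_data K L) (tau : forall A : obj K, hom (F A) (G A)) : Prop :=
  forall (A B : obj K) (h : hom A B),
    hcomp (tau B) (fmap F h) = hcomp (fmap G h) (tau A).

Record bsignature := BSignature {
  bsig :> signature;
  czero : csym bsig;
  cone : csym bsig;
  czero_neq_cone : czero <> cone }.

(* true stands for +, false for -. *)
Definition polarity (S : signature) := forall f : fsym S, 'I_(ar f) -> bool.

Record bounded_poalgebra (S : bsignature) (rho : polarity S) (A : algebra S)
    (le : A -> A -> Prop) : Prop := BoundedPoalgebra {
  po_refl : forall a, le a a;
  po_anti : forall a b, le a b -> le b a -> a = b;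
  po_trans : forall a b c, le a b -> le b c -> le a c;
  po_mono : forall f (k : 'I_(ar f)) (a b : 'I_(ar f) -> A),
    (forall j, j != k -> a j = b j) -> le (a k) (b k) ->
    if rho f k then le (op A f a) (op A f b) else le (op A f b) (op A f a);
  po_ge0 : forall a, le (cst A (czero S)) a;
  po_le1 : forall a, le a (cst A (cone S)) }.

Inductive xy := vx | vy.

Definition valxy (A : Type) (a b : A) (w : xy) : A :=
  match w with vx => a | vy => b end.

Definition eq_le (S : signature) (E : equation S xy -> Prop) (A : algebra S)
    (a b : A) : Prop :=
  forall e, E e -> holds (valxy a b) e.

Arguments eq_le {S} E A a b.

Definition determines_order (S : signature) (E : equation S xy -> Prop)
    (A : algebra S) (le : A -> A -> Prop) : Prop :=
  forall a b, le a b <-> eq_le E A a b.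

Definition poalgebras_ordered_by (S : bsignature) (rho : polarity S)
    (E : equation S xy -> Prop) (Q : algebra S -> Prop) : Prop :=
  forall A, Q A ->
    exists le : A -> A -> Prop,
      bounded_poalgebra rho le /\ determines_order E le.

Inductive ecsym (S : signature) := ECst of csym S | EIota.
Inductive efsym (S : signature) := EFun of fsym S | EDelta | ENabla.

Arguments EIota {S}.
Arguments EDelta {S}.
Arguments ENabla {S}.

Definition ext_sig (S : signature) : signature :=
  @Signature (ecsym S) (efsym S)
    (fun f => match f with EFun f => ar f | EDelta | ENabla => 1 end).

Definition ocst (S : signature) (J : algebra (ext_sig S)) (c : csym S) : J :=
  @cst (ext_sig S) J (ECst c).
Definition oop (S : signature) (J : algebra (ext_sig S)) (f : fsym S)
    (a : 'I_(ar f) -> J) : J :=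
  @op (ext_sig S) J (EFun f) a.
Definition Delta (S : signature) (J : algebra (ext_sig S)) (x : J) : J :=
  @op (ext_sig S) J EDelta (fun=> x).
Definition Nabla (S : signature) (J : algebra (ext_sig S)) (x : J) : J :=
  @op (ext_sig S) J ENabla (fun=> x).

Arguments ocst {S} J c.
Arguments oop {S} J f a.

Record interval (A : Type) (le : A -> A -> Prop) := Interval {
  lo : A;
  hi : A;
  lo_le_hi : le lo hi }.

Lemma intervalE (A : Type) (le : A -> A -> Prop) (x y : interval le) :
  lo x = lo y -> hi x = hi y -> x = y.
Proof.
case: x y => [a b ab] [c d cd] /= ac bd; subst c d.
by congr Interval; apply: Prop_irrelevance.
Qed.

Section IntervalAlgebra.
Variables (S : bsignature) (rho : polarity S) (A : algebra S).
Variables (le : A -> A -> Prop) (poA : bounded_poalgebra rho le).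

Definition lo_args (f : fsym S) (x : 'I_(ar f) -> interval le) (k : 'I_(ar f)) :=
  if rho k then lo (x k) else hi (x k).
Definition hi_args (f : fsym S) (x : 'I_(ar f) -> interval le) (k : 'I_(ar f)) :=
  if rho k then hi (x k) else lo (x k).

Lemma op_lo_le_hi (f : fsym S) (x : 'I_(ar f) -> interval le) :
  le (op A f (lo_args x)) (op A f (hi_args x)).
Proof.
pose mix m (j : 'I_(ar f)) := if j < m then hi_args x j else lo_args x j.
have mix0 : mix 0 = lo_args x by apply: funext.
have mixn : mix (ar f) = hi_args x.
  by apply: funext => j; rewrite /mix ltn_ord.
rewrite -mix0 -mixn; have := leqnn (ar f).
elim: {-2}(ar f) => [|m IH] mf; first exact: (po_refl poA).
apply: (po_trans poA (IH (ltnW mf))).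
pose k := Ordinal mf.
have neq j : j != k -> mix m j = mix m.+1 j.
  move=> jk; rewrite /mix ltnS (leq_eqVlt j m).
  by have /negPf -> : nat_of_ord j != m by apply: contra jk => /eqP jm; apply/eqP/val_inj.
have mk : mix m k = lo_args x k by rewrite /mix /= ltnn.
have mk1 : mix m.+1 k = hi_args x k by rewrite /mix /= leqnn.
have := @po_mono _ _ _ _ poA f k (mix m) (mix m.+1) neq.
have := @po_mono _ _ _ _ poA f k (mix m.+1) (mix m)
  (fun j jk => esym (neq j jk)).
rewrite mk mk1 /lo_args /hi_args; case: (rho k) => H1 H2.
  by apply: H2; apply: lo_le_hi.
by apply: H1; apply: lo_le_hi.
Qed.

Definition diag (a : A) : interval le := Interval (po_refl poA a).

Definition interval_cst (c : ecsym S) : interval le :=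
  match c with
  | ECst c => diag (cst A c)
  | EIota => Interval (po_ge0 poA (cst A (cone S)))
  end.

Definition interval_op (f : efsym S) :
    ('I_(@ar (ext_sig S) f) -> interval le) -> interval le :=
  match f with
  | EFun f => fun x => Interval (op_lo_le_hi x)
  | EDelta => fun x => diag (lo (x ord0))
  | ENabla => fun x => diag (hi (x ord0))
  end.

Definition interval_algebra : algebra (ext_sig S) :=
  @Algebra (ext_sig S) (interval le) interval_cst interval_op.

End IntervalAlgebra.

Section IntervalFunctor.
Variables (S : bsignature) (rho : polarity S).
Variables (E : equation S xy -> Prop) (Q : algebra S -> Prop).
Hypothesis ordQ : poalgebras_ordered_by rho E Q.

Lemma eq_le_poalgebra (A : obj Q) : bounded_poalgebra rho (eq_le E A).
Proof.
have [le [leP leE]] := ordQ (objP A).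
suff <- : le = eq_le E A by [].
by apply: funext => a; apply: funext => b; apply: propext.
Qed.

(* The order witnessed by ordQ is necessarily eq_le E A. *)
Definition Ialg (A : obj Q) : algebra (ext_sig S) :=
  interval_algebra (eq_le_poalgebra A).

Definition IQ : algebra (ext_sig S) -> Prop :=
  generated_quasivariety (fun B => exists A : obj Q, B = Ialg A).

Lemma Ialg_IQ (A : obj Q) : IQ (Ialg A).
Proof. by move=> V _; apply; exists A. Qed.

Lemma hom_eval (A B : algebra S) (h : hom A B) V (v : V -> A) (t : term S V) :
  h (eval v t) = eval (fun x => h (v x)) t.
Proof.
elim: t => [x|c|f ts IH] //=; first exact: (hom_cst (homP h)).
by rewrite (hom_op (homP h)); congr (op B f _); apply: funext => k; apply: IH.
Qed.

Lemma hom_eq_le (A B : algebra S) (h : hom A B) (a b : A) :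
  eq_le E A a b -> eq_le E B (h a) (h b).
Proof.
move=> ab e Ee.
have hv : valxy (h a) (h b) = (fun w => h (valxy a b w)).
  by apply: funext; case.
by rewrite /holds hv -!hom_eval (ab e Ee).
Qed.

Definition Ifun (A B : obj Q) (h : hom A B) (x : Ialg A) : Ialg B :=
  Interval (hom_eq_le h (lo_le_hi x)).

Lemma Ifun_hom (A B : obj Q) (h : hom A B) : is_hom (Ifun h).
Proof.
split=> [[c|]|[f||] a]; apply: intervalE => //=; rewrite ?(hom_cst (homP h)) //.
- rewrite (hom_op (homP h)); congr (op B f _); apply: funext => k.
  by rewrite /lo_args; case: (rho k).
- rewrite (hom_op (homP h)); congr (op B f _); apply: funext => k.
  by rewrite /hi_args; case: (rho k).
Qed.

Definition Ifunctor : functor_data Q IQ :=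
  @FunctorData S (ext_sig S) Q IQ (fun A => Obj (Ialg_IQ A))
    (fun A B h => Hom (Ifun_hom h)).

Lemma Ifunctor_is_functor : is_functor Ifunctor.
Proof. by split=> *; apply: homE => x; apply: intervalE. Qed.

End IntervalFunctor.

Section Centre.
Variable S : signature.

Definition Cset (J : algebra (ext_sig S)) (x : J) : Prop :=
  Nabla x = x /\ x = Delta x.

Definition sigma_closed (J : algebra (ext_sig S)) (X : J -> Prop) : Prop :=
  (forall c, X (ocst J c)) /\
  (forall f (a : 'I_(ar f) -> J), (forall k, X (a k)) -> X (oop J f a)).

Definition Calg (J : algebra (ext_sig S)) (clJ : sigma_closed (@Cset J)) :
    algebra S :=
  @Algebra S {x : J | Cset x}
    (fun c => exist _ (ocst J c) (clJ.1 c))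
    (fun f a => exist _ (oop J f (fun k => sval (a k)))
                        (clJ.2 f _ (fun k => svalP (a k)))).

Definition Cfun (J K : algebra (ext_sig S)) (g : J -> K)
    (gC : forall x, Cset x -> Cset (g x)) (x : {x : J | Cset x}) :
    {x : K | Cset x} :=
  exist _ (g (sval x)) (gC _ (svalP x)).

(* The arguments are exactly the well-definedness conditions on C: closure of
   C(J) under the operations, membership of C(J) in Q, and the restrictions
   being homomorphisms between the algebras C(J). *)
Definition Cfunctor (Q : algebra S -> Prop) (R : algebra (ext_sig S) -> Prop)
    (Ccl : forall J : obj R, sigma_closed (@Cset J))
    (CQ : forall J : obj R, Q (Calg (Ccl J)))
    (CC : forall (J K : obj R) (g : hom J K) (x : J), Cset x -> Cset (g x))
    (Chom : forall (J K : obj R) (g : hom J K),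
       @is_hom S (Calg (Ccl J)) (Calg (Ccl K)) (Cfun (@CC J K g))) :
    functor_data R Q :=
  @FunctorData (ext_sig S) S R Q (fun J => Obj (CQ J))
    (fun J K g => Hom (Chom J K g)).

End Centre.

(* Main.v *)
Require Import Defs.
From mathcomp Require Import all_boot.
From mathcomp Require Import boolp.

Set Implicit Arguments.
Unset Strict Implicit.
Unset Printing Implicit Defensive.

(** An algebra J in IQ satisfies every quasi-equation valid in all interval
    algebras I(A).  In I(A) the elements Delta x and Nabla x are degenerate
    intervals, and the degenerate intervals form a copy of A.  Hence
    substituting terms Delta x or Nabla x for the variables of a
    Sigma-quasi-equation valid in Q gives a quasi-equation valid in IQ, and this
    one says that C(J) satisfies the original at the elements Delta x and
    Nabla x.  Both C(J) in Q and Delta x <= Nabla x in C(J) are instances.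
    Injectivity of gamma and faithfulness of C rest on the quasi-equation
    Delta x = Delta y, Nabla x = Nabla y => x = y. *)

Lemma sval_inj (T : Type) (P : T -> Prop) : injective (@sval T P).
Proof. by move=> [x Px] [y Py]; apply: eq_exist. Qed.

Section Homomorphisms.
Variable S : signature.
Implicit Types A B C : algebra S.

Lemma inj_comp_is_hom A B C (m : hom B C) (h : A -> B) :
  injective m -> is_hom (fun x => m (h x)) -> is_hom h.
Proof.
move=> m_inj mh_hom; split=> [c|f a]; apply: m_inj.
  by rewrite (hom_cst mh_hom) (hom_cst (homP m)).
by rewrite (hom_op mh_hom) (hom_op (homP m)).
Qed.

Lemma cancel_isomorphism A B (h : hom A B) (k : B -> A) :
  cancel h k -> cancel k h -> isomorphism h.
Proof.
move=> hK kK; have k_hom : is_hom k.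
  apply: (inj_comp_is_hom (can_inj hK)).
  by rewrite (funext kK : (fun y => h (k y)) = id); apply: is_hom_id.
by exists (Hom k_hom); split; apply: homE.
Qed.

End Homomorphisms.

Lemma holds_hom_inj (S : bsignature) (A B : algebra S) (h : hom A B) V
    (v : V -> A) (e : equation S V) :
  injective h -> holds (fun x => h (v x)) e <-> holds v e.
Proof. by move=> h_inj; rewrite /holds -!hom_eval; split=> [/h_inj|->]. Qed.

Section QuasiEquations.
Variable S : signature.
Implicit Types (A : algebra S) (K : algebra S -> Prop).

Fixpoint subst (V W : Type) (sigma : V -> term S W) (t : term S V) : term S W :=
  match t with
  | Var x => sigma x
  | Cst c => Cst W c
  | App f ts => App (fun k => subst sigma (ts k))
  end.

Definition subst_equation (V W : Type) (sigma : V -> term S W)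
    (e : equation S V) : equation S W :=
  (subst sigma e.1, subst sigma e.2).

Lemma eval_subst A (V W : Type) (sigma : V -> term S W) (u : W -> A) t :
  eval u (subst sigma t) = eval (fun x => eval u (sigma x)) t.
Proof.
by elim: t => //= f ts IH; congr (op A f _); apply: funext => k; apply: IH.
Qed.

Lemma holds_subst A (V W : Type) (sigma : V -> term S W) (u : W -> A) e :
  holds u (subst_equation sigma e) = holds (fun x => eval u (sigma x)) e.
Proof. by rewrite /holds !eval_subst. Qed.

Definition entails A (V I : Type) (p : I -> equation S V) (e : equation S V) :
    Prop :=
  forall v : V -> A, (forall i, holds v (p i)) -> holds v e.

Definition quasiequation_of (V : countType) (I : finType)
    (p : I -> equation S V) (e : equation S V) : quasiequation S :=
  let rename := subst_equation (fun x => Var S (pickle x)) in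
  Quasiequation (fun i : 'I_#|I| => rename (p (enum_val i))) (rename e).

Lemma satisfies_quasiequation_of A (V : countType) (I : finType)
    (p : I -> equation S V) (e : equation S V) :
  satisfies A (quasiequation_of p e) <-> entails A p e.
Proof.
split=> [Aq v vp | Ape u up].
  (* [eval v e.1] is a default value available even when V is empty. *)
  pose u n := oapp v (eval v e.1) (unpickle n).
  have uE : (fun x => u (pickle x)) = v.
    by apply: funext => x; rewrite /u pickleK.
  have := Aq u; rewrite /= holds_subst /= uE; apply=> i.
  by rewrite holds_subst /= uE.
rewrite /= holds_subst; apply: Ape => i.
by have := up (enum_rank i); rewrite /= holds_subst enum_rankK.
Qed.

Lemma quasivariety_satisfies (q : quasiequation S) :
  quasivariety (fun A => satisfies A q).
Proof. by exists (eq q) => A; split=> [Aq _ <- //|]; apply. Qed.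

Lemma generated_quasivariety_entails K A (V : countType) (I : finType)
    (p : I -> equation S V) (e : equation S V) :
  generated_quasivariety K A -> (forall B, K B -> entails B p e) ->
  entails A p e.
Proof.
move=> KA Kpe; apply/satisfies_quasiequation_of.
apply: (KA (fun B => satisfies B _)); first exact: quasivariety_satisfies.
by move=> B KB; apply/satisfies_quasiequation_of/Kpe.
Qed.

End QuasiEquations.

Section ExtendedAlgebras.
Variable S : signature.
Implicit Types J K : algebra (ext_sig S).

Definition reduct J : algebra S := Algebra (ocst J) (oop J).

Lemma reduct_is_hom J K (g : hom J K) : @is_hom S (reduct J) (reduct K) g.
Proof.
by split=> [c|f a]; [apply: (hom_cst (homP g)) | apply: (hom_op (homP g))].
Qed.

(** [true] selects the lower endpoint; as [rho k = true] when f is monotone in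
    its k-th argument, endpoint [d] of a value of f is computed from endpoint
    [d == rho k] of the k-th argument. *)
Definition endpoint J (d : bool) (x : J) : J := if d then Delta x else Nabla x.

Lemma CsetP J (x : J) : Cset x <-> forall d, endpoint d x = x.
Proof.
split=> [[Nx Dx] [] // | ex].
by split; [exact: (ex false) | exact/esym/(ex true)].
Qed.

Lemma hom_endpoint J K (g : hom J K) d x : g (endpoint d x) = endpoint d (g x).
Proof. by case: d; apply: (hom_op (homP g)). Qed.

Lemma hom_Cset J K (g : hom J K) x : Cset x -> Cset (g x).
Proof. by move=> /CsetP ex; apply/CsetP => d; rewrite -hom_endpoint ex. Qed.

Lemma is_hom_ext_sig J K (h : J -> K) :
    @is_hom S (reduct J) (reduct K) h ->
    h (cst J EIota) = cst K EIota ->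
    (forall d x, h (endpoint d x) = endpoint d (h x)) ->
  is_hom h.
Proof.
move=> h_hom h_iota h_end.
have constE (a : 'I_1 -> J) : a = fun=> a ord0.
  by apply: funext => k; rewrite ord1.
split=> [[c|] // | [f||] a].
- exact: (hom_cst h_hom).
- exact: (hom_op h_hom).
- by rewrite (constE a); apply: (h_end true).
- by rewrite (constE a); apply: (h_end false).
Qed.

Fixpoint ext_term (V : Type) (t : term S V) : term (ext_sig S) V :=
  match t with
  | Var x => Var (ext_sig S) x
  | Cst c => @Cst (ext_sig S) V (ECst c)
  | App f ts => @App (ext_sig S) V (EFun f) (fun k => ext_term (ts k))
  end.

Lemma eval_ext_term J (V : Type) (v : V -> J) t :
  eval v (ext_term t) = eval (A := reduct J) v t.
Proof.
by elim: t => //= f ts IH; congr (op J _ _); apply: funext => k; apply: IH.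
Qed.

Definition term_endpoint (V : Type) (d : bool) (t : term (ext_sig S) V) :
    term (ext_sig S) V :=
  if d then @App (ext_sig S) V EDelta (fun=> t)
  else @App (ext_sig S) V ENabla (fun=> t).

Lemma eval_term_endpoint J (V : Type) (v : V -> J) d t :
  eval v (term_endpoint d t) = endpoint d (eval v t).
Proof. by case: d. Qed.

Definition endpoint_equation (V W : Type) (d : V -> bool) (r : V -> W)
    (e : equation S V) : equation (ext_sig S) W :=
  subst_equation (fun x => term_endpoint (d x) (Var _ (r x)))
    (ext_term e.1, ext_term e.2).

Lemma holds_endpoint_equation J (V W : Type) (d : V -> bool) (r : V -> W)
    (u : W -> J) e :
  holds u (endpoint_equation d r e) =
  holds (A := reduct J) (fun x => endpoint (d x) (u (r x))) e.
Proof.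
rewrite holds_subst /holds /= !eval_ext_term.
by rewrite (funext (fun x => eval_term_endpoint u (d x) (Var _ (r x)))).
Qed.

Lemma sval_is_hom J (clJ : sigma_closed (@Cset S J)) :
  @is_hom S (Calg clJ) (reduct J) sval.
Proof. by []. Qed.

Definition center_incl J (clJ : sigma_closed (@Cset S J)) :
    hom (Calg clJ) (reduct J) :=
  Hom (sval_is_hom clJ).

Lemma center_incl_inj J (clJ : sigma_closed (@Cset S J)) :
  injective (center_incl clJ).
Proof. exact: sval_inj. Qed.

Lemma Cfun_is_hom J K (clJ : sigma_closed (@Cset S J))
    (clK : sigma_closed (@Cset S K)) (g : hom J K)
    (gC : forall x : J, Cset x -> Cset (g x)) :
  @is_hom S (Calg clJ) (Calg clK) (Cfun gC).
Proof.
apply: (inj_comp_is_hom (center_incl_inj (clJ := clK))).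
exact: (is_hom_comp (Hom (reduct_is_hom g)) (center_incl clJ)).
Qed.

End ExtendedAlgebras.

Section CenterFunctor.
Variables (S : signature) (Q : algebra S -> Prop).
Variables (R : algebra (ext_sig S) -> Prop).
Variables (Ccl : forall J : obj R, sigma_closed (@Cset S J)).
Variables (CQ : forall J : obj R, Q (Calg (Ccl J))).
Variables (CC : forall (J K : obj R) (g : hom J K) (x : J),
  Cset x -> Cset (g x)).
Variables (Chom : forall (J K : obj R) (g : hom J K),
  @is_hom S (Calg (Ccl J)) (Calg (Ccl K)) (Cfun (@CC J K g))).

Lemma Cfunctor_is_functor : is_functor (Cfunctor CQ Chom).
Proof. by split=> *; apply: homE => x; apply: sval_inj. Qed.

Lemma Cfunctor_faithful :
    (forall (J : obj R) d (x : J), Cset (endpoint d x)) ->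
    (forall (J : obj R) (x y : J),
       (forall d, endpoint d x = endpoint d y) -> x = y) ->
  faithful (Cfunctor CQ Chom).
Proof.
move=> Cset_end end_inj J K g h gh; apply: homE => x; apply: end_inj => d.
rewrite -!hom_endpoint; pose z : Calg (Ccl J) := exist _ _ (Cset_end J d x).
exact: (congr1 (fun k : hom (Calg (Ccl J)) (Calg (Ccl K)) => sval (k z)) gh).
Qed.

End CenterFunctor.

Section IntervalAlgebras.
Variables (S : bsignature) (rho : polarity S) (A : algebra S).
Variables (le : A -> A -> Prop) (poA : bounded_poalgebra rho le).

Local Notation IA := (interval_algebra poA).

Definition bound (d : bool) (x : interval le) : A := if d then lo x else hi x.

Lemma bound_inj (x y : interval le) :
  (forall d, bound d x = bound d y) -> x = y.
Proof.
by move=> xy; apply: intervalE; [exact: (xy true) | exact: (xy false)].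
Qed.

Lemma bound_diag d a : bound d (diag poA a) = a.
Proof. by case: d. Qed.

Lemma bound_oop d f (x : 'I_(ar f) -> IA) :
  bound d (oop IA f x) = op A f (fun k => bound (d == rho k) (x k)).
Proof.
by case: d; congr (op A f _); apply: funext => k; rewrite /lo_args /hi_args;
  case: (rho k).
Qed.

Lemma endpoint_interval d (x : IA) : endpoint d x = diag poA (bound d x).
Proof. by case: d. Qed.

Lemma diag_is_hom : @is_hom S A (reduct IA) (diag poA).
Proof.
split=> // f a; apply: bound_inj => d; rewrite bound_oop bound_diag.
by congr (op A f _); apply: funext => k; rewrite bound_diag.
Qed.

Definition diag_hom : hom A (reduct IA) := Hom diag_is_hom.

Lemma diag_hom_inj : injective diag_hom.
Proof. exact: (can_inj (bound_diag true)). Qed.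

Lemma endpoint_oop_interval d f (x : 'I_(ar f) -> IA) :
  endpoint d (oop IA f x) = oop IA f (fun k => endpoint (d == rho k) (x k)).
Proof.
rewrite endpoint_interval bound_oop (hom_op diag_is_hom).
by congr (op IA _ _); apply: funext => k; rewrite endpoint_interval.
Qed.

Lemma Cset_diag a : @Cset S IA (diag poA a).
Proof. by apply/CsetP => d; rewrite endpoint_interval bound_diag. Qed.

Lemma diag_lo (x : IA) : Cset x -> diag poA (lo x) = x.
Proof. by move=> /CsetP/(_ true). Qed.

Variable clIA : sigma_closed (@Cset S IA).

Lemma center_diag_is_hom :
  @is_hom S A (Calg clIA) (fun a => exist _ (diag poA a) (Cset_diag a)).
Proof.
apply: (inj_comp_is_hom (center_incl_inj (clJ := clIA))).
exact: diag_is_hom.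
Qed.

Definition center_diag : hom A (Calg clIA) := Hom center_diag_is_hom.

Lemma center_diag_isomorphism : isomorphism center_diag.
Proof.
apply: (@cancel_isomorphism _ _ _ center_diag (fun x => lo (sval x))) => // x.
by apply: sval_inj; apply: (diag_lo (svalP x)).
Qed.

End IntervalAlgebras.

Section IntervalQuasivariety.
Variables (S : bsignature) (rho : polarity S).
Variables (E : equation S xy -> Prop) (Q : algebra S -> Prop).
Hypothesis ordQ : poalgebras_ordered_by rho E Q.

Lemma IQ_entails (V : countType) (I : finType)
    (p : I -> equation (ext_sig S) V) (e : equation (ext_sig S) V) :
    (forall A : obj Q, entails (Ialg ordQ A) p e) ->
  forall J : obj (IQ ordQ), entails J p e.
Proof.
move=> Ipe J; apply: (generated_quasivariety_entails (objP J)).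
by move=> _ [A ->]; apply: Ipe.
Qed.

Lemma IQ_identity (V : countType) (t s : term (ext_sig S) V) :
    (forall (A : obj Q) (u : V -> Ialg ordQ A), eval u t = eval u s) ->
  forall (J : obj (IQ ordQ)) (u : V -> J), eval u t = eval u s.
Proof.
move=> ts J u; apply: (@IQ_entails V void (of_void _) (t, s)) => [A w _|[]].
exact: ts.
Qed.

Section Identities.
Variable J : obj (IQ ordQ).
Implicit Types x y : J.

Lemma endpoint_idem c d x : endpoint c (endpoint d x) = endpoint d x.
Proof.
pose t := term_endpoint d (Var (ext_sig S) tt).
have := @IQ_identity _ (term_endpoint c t) t _ J (fun=> x).
rewrite !eval_term_endpoint; apply=> A u.
by rewrite !eval_term_endpoint !endpoint_interval bound_diag.
Qed.

Lemma Cset_endpoint d x : Cset (endpoint d x).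
Proof. by apply/CsetP => c; apply: endpoint_idem. Qed.

Lemma endpoint_ocst d c : endpoint d (ocst J c) = ocst J c.
Proof.
pose t := @Cst (ext_sig S) void (ECst c).
have := @IQ_identity _ (term_endpoint d t) t _ J (of_void J).
rewrite eval_term_endpoint; apply=> A u.
by rewrite eval_term_endpoint endpoint_interval bound_diag.
Qed.

Lemma endpoint_iota d :
  endpoint d (cst J EIota) = ocst J (if d then czero S else cone S).
Proof.
pose t := @Cst (ext_sig S) void EIota.
pose s := @Cst (ext_sig S) void (ECst (if d then czero S else cone S)).
have := @IQ_identity _ (term_endpoint d t) s _ J (of_void J).
rewrite eval_term_endpoint; apply=> A u.
by rewrite eval_term_endpoint endpoint_interval; case: d @s.
Qed.

Lemma endpoint_oop d f (a : 'I_(ar f) -> J) :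
  endpoint d (oop J f a) = oop J f (fun k => endpoint (d == rho k) (a k)).
Proof.
pose x (k : 'I_(ar f)) := Var (ext_sig S) k.
pose t := @App (ext_sig S) _ (EFun f) x.
pose s := @App (ext_sig S) _ (EFun f)
  (fun k => term_endpoint (d == rho k) (x k)).
have sE (K : algebra (ext_sig S)) (u : 'I_(ar f) -> K) :
    eval u s = oop K f (fun k => endpoint (d == rho k) (u k)).
  by congr (op K _ _); apply: funext => k; apply: eval_term_endpoint.
have := @IQ_identity _ (term_endpoint d t) s _ J a.
rewrite eval_term_endpoint sE; apply=> A u.
by rewrite eval_term_endpoint sE; apply: endpoint_oop_interval.
Qed.

Lemma endpoint_inj x y : (forall d, endpoint d x = endpoint d y) -> x = y.
Proof.
move=> xy; pose X := Var (ext_sig S) true; pose Y := Var (ext_sig S) false.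
pose p d := (term_endpoint d X, term_endpoint d Y).
pose v b := if b then x else y.
apply: (@IQ_entails _ _ p (X, Y) _ J v) => [A u up | d].
  apply: bound_inj => d; have := up d.
  by rewrite /holds !eval_term_endpoint !endpoint_interval => /diag_hom_inj.
by rewrite /holds !eval_term_endpoint.
Qed.

Lemma Cset_sigma_closed : sigma_closed (@Cset S J).
Proof.
split=> [c|f a aC]; apply/CsetP => d; first exact: endpoint_ocst.
rewrite endpoint_oop; congr (oop J f _); apply: funext => k.
by have /CsetP -> := aC k.
Qed.

Definition center_endpoint d x : Calg Cset_sigma_closed :=
  exist _ (endpoint d x) (Cset_endpoint d x).

End Identities.

Lemma center_entails (I : finType) (V : Type) (W : countType) (d : V -> bool)
    (r : V -> W) (p : I -> equation S V) (e : equation S V) :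
    (forall (A : obj Q) (w : W -> Ialg ordQ A),
       let v x := bound (d x) (w (r x)) in
       (forall i, holds v (p i)) -> holds v e) ->
  forall (J : obj (IQ ordQ)) (u : W -> J),
    let v x := center_endpoint (d x) (u (r x)) in
    (forall i, holds v (p i)) -> holds v e.
Proof.
move=> Qpe J u v vp.
have holdsJ e' : holds u (endpoint_equation d r e') <-> holds v e'.
  rewrite holds_endpoint_equation.
  exact: (holds_hom_inj v e' (center_incl_inj (clJ := Cset_sigma_closed J))).
apply/holdsJ; apply: (@IQ_entails _ _ (fun i => endpoint_equation d r (p i))).
  move=> A w; pose l x := bound (d x) (w (r x)).
  have holdsI e' : holds w (endpoint_equation d r e') <-> holds l e'.
    rewrite holds_endpoint_equation.
    rewrite (funext (fun x => endpoint_interval (d x) (w (r x)))).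
    exact: (holds_hom_inj l e' (diag_hom_inj (poA := eq_le_poalgebra ordQ A))).
  by move=> wp; apply/holdsI; apply: Qpe => i; apply/holdsI.
by move=> i; apply/holdsJ.
Qed.

Lemma quasivariety_Calg (J : obj (IQ ordQ)) :
  quasivariety Q -> Q (Calg (Cset_sigma_closed J)).
Proof.
case=> T QT; apply/QT => q Tq v.
have vE : v = fun n => center_endpoint true (sval (v n)).
  apply: funext => n; apply/sval_inj/esym.
  by have /CsetP := svalP (v n); apply.
have := @center_entails _ _ nat (fun=> true) id (@premise _ q) (conclusion q).
by rewrite vE; apply=> A w; have /QT/(_ q Tq) := objP A; apply.
Qed.

Lemma center_endpoint_le (J : obj (IQ ordQ)) (x : J) :
  eq_le E (Calg (Cset_sigma_closed J))
    (center_endpoint true x) (center_endpoint false x).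
Proof.
pose d w := if w is vx then true else false.
have valE T (z : bool -> T) : valxy (z true) (z false) = fun w => z (d w).
  by apply: funext; case.
move=> e Ee; rewrite (valE _ (fun b => center_endpoint b x)).
have := @center_entails void _ unit d (fun=> tt) (of_void _) e _ J (fun=> x).
apply=> [A w v _|[]]; rewrite /v -(valE _ (fun b => bound b (w tt))).
exact: (lo_le_hi (w tt) e Ee).
Qed.

Section CenterAndIntervals.
Hypothesis quasiQ : quasivariety Q.

Definition center_functor : functor_data (IQ ordQ) Q :=
  Cfunctor (fun J => quasivariety_Calg J quasiQ)
    (fun J K g => Cfun_is_hom (Cset_sigma_closed J) (Cset_sigma_closed K)
                              (@hom_Cset S J K g)).

Local Notation C := center_functor.
Local Notation I := (Ifunctor ordQ).

Lemma center_diag_natural :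
  natural (F := id_functor Q) (G := comp_functor C I)
    (fun A => center_diag (Cset_sigma_closed (I A))).
Proof.
by move=> A B h; apply: homE => a; apply: sval_inj; apply: intervalE.
Qed.

Definition gamma_fun (J : obj (IQ ordQ)) (x : J) : I (C J) :=
  Interval (center_endpoint_le x).

Lemma bound_gamma (J : obj (IQ ordQ)) d (x : J) :
  bound d (gamma_fun x) = center_endpoint d x.
Proof. by case: d. Qed.

Lemma gamma_is_hom (J : obj (IQ ordQ)) : is_hom (@gamma_fun J).
Proof.
apply: is_hom_ext_sig => [||c x]; first split=> [c|f a].
all: apply: bound_inj => d; rewrite bound_gamma; apply: sval_inj => /=.
- by rewrite endpoint_ocst bound_diag.
- rewrite bound_oop /= endpoint_oop; congr (oop J f _); apply: funext => k.
  by rewrite bound_gamma.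
- by rewrite endpoint_iota; case: d.
- by rewrite endpoint_idem endpoint_interval bound_diag bound_gamma.
Qed.

Definition gamma (J : obj (IQ ordQ)) : hom J (I (C J)) :=
  Hom (@gamma_is_hom J).

Lemma gamma_inj (J : obj (IQ ordQ)) : injective (gamma J).
Proof.
move=> x y xy; apply: endpoint_inj => d.
have := congr1 (bound (A := C J) d) xy; rewrite !bound_gamma.
exact: (congr1 sval).
Qed.

Lemma gamma_natural :
  natural (F := id_functor (IQ ordQ)) (G := comp_functor I C) gamma.
Proof.
move=> J K g; apply: homE => x; apply: intervalE; apply: sval_inj => /=.
  exact/esym/(hom_endpoint g true).
exact/esym/(hom_endpoint g false).
Qed.

End CenterAndIntervals.

End IntervalQuasivariety.

Theorem theorem8p7 (S : bsignature) (rho : polarity S)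
    (E : equation S xy -> Prop) (Q : algebra S -> Prop)
    (quasiQ : quasivariety Q) (ordQ : poalgebras_ordered_by rho E Q) :
  let I : functor_data Q (IQ ordQ) := Ifunctor ordQ in
  (* (i) *)
  exists Ccl : (forall J : obj (IQ ordQ), sigma_closed (@Cset S J)),
  (* (ii) *)
  exists (CQ : forall J : obj (IQ ordQ), Q (Calg (Ccl J)))
         (CC : forall (J K : obj (IQ ordQ)) (g : hom J K) (x : J),
                 Cset x -> Cset (g x))
         (Chom : forall (J K : obj (IQ ordQ)) (g : hom J K),
            @is_hom S (Calg (Ccl J)) (Calg (Ccl K)) (Cfun (CC J K g))),
  let C : functor_data (IQ ordQ) Q := Cfunctor CQ Chom in
  [/\ is_functor C,
      faithful C,
      (* (iii) *)
      exists iota : forall A : obj Q, hom A (C (I A)),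
        [/\ forall (A : obj Q) (a : A),
              sval (iota A a) = diag (eq_le_poalgebra ordQ A) a,
            forall A : obj Q, isomorphism (iota A)
          & natural (F := id_functor Q) (G := comp_functor C I) iota]
      (* (iv) *)
    & exists gamma : forall J : obj (IQ ordQ), hom J (I (C J)),
        [/\ forall (J : obj (IQ ordQ)) (a : J),
              sval (lo (gamma J a)) = Delta a /\
              sval (hi (gamma J a)) = Nabla a,
            forall J : obj (IQ ordQ), injective (gamma J)
          & natural (F := id_functor (IQ ordQ)) (G := comp_functor I C) gamma]].
Proof.
move=> I; exists (@Cset_sigma_closed S rho E Q ordQ).
exists (fun J => quasivariety_Calg J quasiQ), (fun J K => @hom_Cset S J K).
exists (fun J K g => Cfun_is_hom (Cset_sigma_closed J) (Cset_sigma_closed K)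
                                 (@hom_Cset S J K g)) => C.
split.
- exact: Cfunctor_is_functor.
- apply: Cfunctor_faithful; [exact: Cset_endpoint | exact: endpoint_inj].
- exists (fun A => center_diag (Cset_sigma_closed (I A))); split=> [//|A|].
    exact: center_diag_isomorphism.
  exact: (center_diag_natural ordQ quasiQ).
- exists (gamma quasiQ).
  by split=> //; [exact: gamma_inj | exact: gamma_natural].
Qed.
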